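(* For any non-negative integer $d$, we have $$\zeta^\star(\{3,1\}^d) = 4\pi^{4d}\sum_{k=0}^{2d}(-1)^k(4^{k+1}-1)\,\frac{B_{2k+2}}{(2k+2)!}\,\frac{B_{4d-2k}}{(4d-2k)!}$$ and $$\zeta^\star(\{3,1\}^d, 2) = 4\pi^{4d+2}\sum_{k=0}^{2d+1}(-1)^k(4^{k+1}-1)\,\frac{B_{2k+2}}{(2k+2)!}\,\frac{B_{4d+2-2k}}{(4d+2-2k)!}.$$
   Context: For positive integers $s_1,\ldots,s_r$ with $s_1>1$, the multiple zeta star value is $\zeta^\star(s_1,\ldots,s_r)=\sum_{k_1\ge\cdots\ge k_r\ge 1}\frac{1}{k_1^{s_1}\cdots k_r^{s_r}}$ (sum over positive integers); by convention $\zeta^\star(\emptyset)=1$ for the empty index. The notation $\{a_1,\ldots,a_k\}^d$ means $d$ successive repetitions of the sequence $a_1,\ldots,a_k$ (the empty sequence if $d=0$). The Bernoulli numbers $B_s$ are defined by $\frac{t}{e^t-1}=\sum_{s=0}^\infty B_s\frac{t^s}{s!}$. *)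

(* Defs.v *)
From HB Require Import structures.
From mathcomp Require Import all_boot all_order all_algebra.
From mathcomp Require Import ring lra.
From mathcomp Require Import all_classical all_reals all_analysis.
Set Implicit Arguments.
Unset Strict Implicit.
Unset Printing Implicit Defensive.
Import Order.TTheory GRing.Theory Num.Theory.
Import numFieldNormedType.Exports.
Local Open Scope classical_set_scope.
Local Open Scope ring_scope.

Definition star_tuples (r : nat) : set (seq nat) :=
  [set k | [/\ size k = r, sorted geq k & all (leq 1) k]].

(* The unordered sum [esum] lives in [\bar R]: for a divergent index
   (s_1 = 1) the value is +oo, and an equation [zeta_star s = x%:E] also says
   that the series converges. For [s = [::]] the only tuple is [[::]], whose
   term is the empty product. *)
Definition zeta_star (R : realType) (s : seq nat) : \bar R :=
  \esum_(k in star_tuples (size s))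
    (\prod_(i < size s) (nth 0%N k i)%:R ^- nth 0%N s i)%:E.

Definition repeat_index (d : nat) (a : seq nat) : seq nat :=
  flatten (nseq d a).

(* t = 0 is left out because t / (e^t - 1) is 0 there with [x / 0 = 0]; its
   removable value B_0 = 1 is already forced by the punctured neighbourhood. *)
Definition is_bernoulli (R : realType) (B : nat -> R) : Prop :=
  \forall t \near (0 : R)^',
    pseries (fun s => B s / (s`!)%:R) t @ \oo --> t / (expR t - 1).

(* Coefficients of (e^t - 1) / t. The lemmas below show that [is_bernoulli] is
   satisfiable: the inverse power series has coefficients bounded by 1. *)
Definition expm1_coeff (R : realType) (n : nat) : R := ((n.+1)`!%:R)^-1.
Local Notation c := (@expm1_coeff _).

Lemma expm1_coeff_inverse (R : realType) : exists b : nat -> R,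
  forall n, \sum_(i < n.+1) b i * c (n - i) = (n == 0%N)%:R.
Proof.
pose nxt (s : seq R) := (size s == 0%N)%:R - \sum_(i < size s) s`_i * c (size s - i).
pose bl := fix bl n : seq R := if n is m.+1 then rcons (bl m) (nxt (bl m)) else [::].
have sz n : size (bl n) = n by elim: n => //= n IH; rewrite size_rcons IH.
have st n m i : (i < n)%N -> (n <= m)%N -> (bl m)`_i = (bl n)`_i.
  move=> lin; elim: m => [|m IH]; first by rewrite leqn0 => /eqP ->.
  rewrite leq_eqVlt => /orP[/eqP -> //|]; rewrite ltnS => nm /=.
  by rewrite nth_rcons sz (leq_trans lin nm) IH.
exists (fun n => (bl n.+1)`_n) => n.
rewrite big_ord_recr /= nth_rcons sz ltnn eqxx subnn /nxt sz.
rewrite [c 0](_ : _ = 1) ?mulr1; last by rewrite /expm1_coeff invr1.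
rewrite addrCA -sumrB big1 ?addr0 // => i _.
by rewrite -(st i.+1 n) ?(st i.+1 i.+1) ?ltnS // subrr.
Qed.

Lemma expm1_coeff_le (R : realType) n : c n <= 2^-1 ^+ n :> R.
Proof.
rewrite /expm1_coeff exprVn lef_pV2 ?posrE ?exprn_gt0 ?ltr0n ?fact_gt0 //.
rewrite -natrX ler_nat; elim: n => // n IH.
by rewrite expnS factS leq_mul.
Qed.

Lemma sum_half_le1 (R : realType) n : \sum_(i < n) (2^-1 : R) ^+ (n - i) <= 1.
Proof.
elim: n => [|n IH]; first by rewrite big_ord0 ler01.
rewrite (eq_bigr (fun i : 'I_n.+1 => 2^-1 * (2^-1 : R) ^+ (n - i))); last first.
  by move=> i _; rewrite subSn ?exprS // -ltnS.
by rewrite -mulr_sumr big_ord_recr /= subnn expr0; lra.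
Qed.

Lemma expm1_inverse_le1 (R : realType) (b : nat -> R) :
  (forall n, \sum_(i < n.+1) b i * c (n - i) = (n == 0%N)%:R) ->
  forall n, `|b n| <= 1.
Proof.
move=> hb; elim/ltn_ind => n IH; have := hb n.
rewrite big_ord_recr /= subnn [c 0](_ : _ = 1) ?mulr1; last by rewrite /expm1_coeff invr1.
case: n IH => [|n] IH; first by rewrite big_ord0 add0r => ->; rewrite normr1.
move=> /eqP; rewrite addrC addr_eq0 => /eqP ->; rewrite normrN.
apply: le_trans (sum_half_le1 R n.+1); apply: le_trans (ler_norm_sum _ _ _) _.
apply: ler_sum => i _; rewrite normrM -[leRHS]mul1r.
by rewrite ler_pM ?IH ?[`|c _|]ger0_norm ?expm1_coeff_le ?invr_ge0.
Qed.

Lemma expm1_inverse_prod (R : realType) (b : nat -> R) (t : R) n :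
  (forall n, \sum_(i < n.+1) b i * c (n - i) = (n == 0%N)%:R) ->
  `|t| < 8^-1 -> (0 < n)%N ->
  `|(\sum_(i < n) b i * t ^+ i) * (\sum_(i < n) c i * t ^+ i) - 1| <= 2 * (2^-1) ^+ n.
Proof.
move=> hb ht n0.
pose P := \poly_(i < n) b i; pose Q := \poly_(i < n) (c i : R).
rewrite -!horner_poly -/P -/Q -hornerM.
have sPQ : (size (P * Q)%R <= n + n)%N.
  apply: leq_trans (size_polyMleq _ _) _; apply: leq_trans (leq_pred _) _.
  by rewrite leq_add ?size_poly.
rewrite (horner_coef_wide _ sPQ) big_split_ord /=.
have -> : \sum_(i < n) (P * Q)`_i * t ^+ i = 1.
  case: n n0 @P @Q sPQ => // n _ P Q _; rewrite big_ord_recl /= big1 ?addr0.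
    rewrite coefM big_ord_recr big_ord0 /= !coef_poly /= add0r expr0 mulr1.
    by have := hb 0; rewrite big_ord_recr big_ord0 /= add0r.
  move=> i _; rewrite coefM (_ : \sum_(_ < _) _ = 0) ?mul0r //.
  rewrite -[RHS](hb (bump 0 i)); apply: eq_bigr => j _.
  have ltm : (bump 0 i < n.+1)%N by rewrite /bump add1n ltnS.
  by rewrite !coef_poly (leq_trans (ltn_ord j)) // (leq_ltn_trans (leq_subr _ _)).
rewrite addrAC subrr add0r.
apply: le_trans (ler_norm_sum _ _ _) _.
apply: (@le_trans _ _ (\sum_(i < n) (n + n)%:R * `|t| ^+ n)).
  apply: ler_sum => i _; rewrite normrM normrX ler_pM //.
    rewrite coefM; apply: le_trans (ler_norm_sum _ _ _) _.
    apply: (@le_trans _ _ (\sum_(j < (n + i).+1) 1)); last first.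
      by rewrite sumr_const card_ord ler_nat -addnS leq_add2l.
    apply: ler_sum => j _; rewrite !coef_poly normrM -[leRHS]mul1r ler_pM //.
      by case: ifP => _; rewrite ?normr0 ?ler01 ?(expm1_inverse_le1 hb).
    case: ifP => _; rewrite ?normr0 ?ler01 // ger0_norm /expm1_coeff ?invr_ge0 //.
    by rewrite invf_le1 ?ler1n ?ltr0n ?fact_gt0.
  rewrite exprD ler_piMr ?exprn_ge0 // exprn_ile1 //; lra.
rewrite sumr_const card_ord -[_ *+ n]mulr_natl mulrA -natrM.
have h8 : `|t| ^+ n <= 8^-1 ^+ n by apply: lerXn2r; rewrite ?nnegrE //; lra.
apply: (@le_trans _ _ ((2 * (2 ^ n * 2 ^ n))%:R * 8^-1 ^+ n)).
  apply: ler_pM; rewrite ?exprn_ge0 // ler_nat addnn -muln2.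
  rewrite mulnA [(n * n * 2)%N]mulnC leq_mul2l /=.
  by rewrite leq_mul // ltnW // ltn_expl.
rewrite !natrM !natrX -mulrA -!exprMn ler_wpM2l //.
by rewrite (_ : 2 * 2 * 8^-1 = 2^-1 :> R) //; field.
Qed.

Lemma is_bernoulli_exists (R : realType) : exists B : nat -> R, is_bernoulli B.
Proof.
have [b hb] := expm1_coeff_inverse R; exists (fun n => b n * n`!%:R).
rewrite /is_bernoulli; near=> t.
have t0 : t != 0 by near: t; exact: nbhs_dnbhs_neq.
have t8 : `|t| < 8^-1 by near: t; apply: dnbhs0_lt; rewrite invr_gt0.
have -> : (fun s : nat => b s * s`!%:R / s`!%:R) = b.
  by apply/funext => s; rewrite mulfK // pnatr_eq0 -lt0n fact_gt0.
have e0 : expR t - 1 != 0 by rewrite subr_eq0 -expR0 (inj_eq (@expR_inj R)).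
have hC : (fun n => \sum_(i < n) c i * t ^+ i : R) @ \oo --> (expR t - 1) / t.
  have -> : (fun n => \sum_(i < n) c i * t ^+ i : R) =
            (fun n => (series (exp_coeff t) n.+1 - 1) / t).
    apply/funext => n; rewrite /series /= big_mkord big_ord_recl /exp_coeff /=.
    rewrite expr0 divr1 addrC addrA addNr add0r mulr_suml; apply: eq_bigr => i _.
    by rewrite /expm1_coeff /bump /= add1n exprS; field; rewrite t0 pnatr_eq0 -lt0n fact_gt0.
  apply: cvgMl; apply: cvgB; last exact: cvg_cst.
  have := @is_cvg_series_exp_coeff _ t; rewrite -(cvg_shiftS (series _)).
  exact.
have hP : (fun n => (\sum_(i < n) b i * t ^+ i) * (\sum_(i < n) c i * t ^+ i))
    @ \oo --> (1 : R).
  apply/subr_cvg0/norm_cvg0P => /=.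
  apply: (@squeeze_cvgr _ _ _ _ (cst 0) (geometric (2 : R) 2^-1)).
  - near=> n; rewrite normr_ge0 /=; apply: expm1_inverse_prod => //.
    by near: n; exists 1%N.
  - exact: cvg_cst.
  - by apply: cvg_geometric; rewrite ger0_norm ?invr_ge0 // invf_lt1 // ltr1n.
have eC : (expR t - 1) / t != 0 by rewrite mulf_neq0 ?invr_eq0.
have h : (fun n => (\sum_(i < n) b i * t ^+ i) * (\sum_(i < n) c i * t ^+ i)
    / (\sum_(i < n) c i * t ^+ i)) @ \oo --> t / (expR t - 1).
  by rewrite -[t / _]mul1r -(invf_div (expR t - 1)); apply: cvgM hP (cvgV eC hC).
apply: (cvg_trans _ h); apply: near_eq_cvg.
have hn : \forall n \near \oo, \sum_(i < n) c i * t ^+ i != 0.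
  exact: (cvgr_neq0 _ hC).
near=> n; rewrite /pseries /series /= big_mkord.
by rewrite mulfK //; near: n.
Unshelve. all: by end_near. Qed.

(* Main.v *)
Require Import Defs.
From HB Require Import structures.
From mathcomp Require Import all_boot all_order all_algebra.
From mathcomp Require Import ring lra zify.
From mathcomp Require Import all_classical all_reals all_analysis.
Set Implicit Arguments.
Unset Strict Implicit.
Unset Printing Implicit Defensive.
Import Order.TTheory GRing.Theory Num.Theory.
Import numFieldNormedType.Exports.
Local Open Scope classical_set_scope.
Local Open Scope ring_scope.

(** The two formulas are the even and the odd coefficients of one generating
series. Write [y] for a formal variable that counts half the weight and let
[idx N] be [{3,1}^d] if [N = 2d] and [({3,1}^d, 2)] if [N = 2d+1]. The theorem
says that the sum over [N] of [zeta*(idx N) y^N] is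
[tan (z/2) / tanh (z/2)] with [z = pi sqrt y]: by the Euler formula for the
cotangent, the Bernoulli convolution on the right-hand side is the Cauchy
product of the series of [tan (z/2) / (z/2)] and of [(z/2) coth (z/2)].

The quotient also has an infinite product: it is the limit of
[rho_l = prod_(k <= l) (1 - e_k y / k^2) / (1 + e_k y / k^2)], [e_k = (-1)^k].
The heart of the proof is a finite identity between these products and the
star sums truncated at [k_1 <= n]. With the kernel
[c(n,l) = n!^2 / ((n-l)! (n+l)!)], the truncated star sum of [idx N] is the
coefficient of [y^N] in [sum_(l <= n) (c(n,l) - c(n,l+1)) rho_l]
([star_sum_index]). It is proved by checking that both sides satisfy the same
recurrence in [n]; only two relations for the kernel enter, one for its
difference in [n] ([kernel_sub]) and one for its difference in [l]
([kernel_diff]), together with summation by parts. The weights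
[c(n,l) - c(n,l+1)] are nonnegative, have sum 1 and tend to 0 for fixed [l],
so the truncated sums have the same limit as [rho_l], coefficient by
coefficient ([kernel_mean_cvg]).

It remains to evaluate the limit of [rho_l]. The integrals from
0 to [pi/2] of [t^(2N) cos^n t / (2N)!], normalised so that the one for [N = 0]
is 1, are for each [n] the coefficients of a series [j_n] in [y] with
[(1 + y / n^2) j_n = j_(n-2)], whose initial terms [j_0] and [(1 + y) j_1] are the series of [sinh (z/2) / (z/2)] and [cosh (z/2)]; moreover
[j_n] tends to 1 because [t cos t <= sin t]. This is the product formula for
sine and cosine at the level of coefficients, and passing from [y] to [-y] is
a formal operation. Hence the limit [r] of [rho_l] satisfies
[r * sinhc(y) * cosh(-y) = sinhc(-y) * cosh(y)] ([rho_limit]). The Bernoulli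
side satisfies the same equation ([bernoulli_coth_tanh]), and formal power
series over a field have no zero divisors. *)

(** * Formal power series *)

(** The alias hides the pointwise ring structure of functions, so that the
product below, the Cauchy product, can be the canonical one. *)
Definition fps (R : realType) := nat -> R.
HB.instance Definition _ (R : realType) :=
  GRing.Zmodule.copy (fps R) (nat -> R).

Section FpsRing.
Variable R : realType.
Implicit Types f g h : fps R.

Definition fps_mul f g : fps R := fun n => \sum_(i < n.+1) f i * g (n - i)%N.
Definition fps_one : fps R := fun n => (n == 0)%:R.

(** The ring laws are inherited from polynomials: a coefficient of a product
depends on finitely many coefficients of the factors. *)
Lemma fps_mul_coef_poly f g m n : (n < m)%N ->
  fps_mul f g n = (\poly_(i < m) f i * \poly_(i < m) g i)`_n.
Proof.
move=> nm; rewrite coefM; apply: eq_bigr => i _; rewrite !coef_poly.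
rewrite (leq_ltn_trans (leq_subr _ _) nm).
by rewrite (leq_ltn_trans _ nm) // -ltnS.
Qed.

Lemma coefM_poly_trunc (p q : {poly R}) m n : (n < m)%N ->
  (\poly_(i < m) p`_i * \poly_(i < m) q`_i)`_n = (p * q)`_n.
Proof.
move=> nm; rewrite !coefM; apply: eq_bigr => i _; rewrite !coef_poly.
rewrite (leq_ltn_trans (leq_subr _ _) nm).
by rewrite (leq_ltn_trans _ nm) // -ltnS.
Qed.

Lemma fps_mul_poly f g m :
  \poly_(i < m) fps_mul f g i =
  \poly_(i < m) (\poly_(i < m) f i * \poly_(i < m) g i)`_i.
Proof.
apply/polyP => i; rewrite !coef_poly; case: ltnP => // im.
exact: fps_mul_coef_poly.
Qed.

Lemma fps_mulC : commutative fps_mul.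
Proof.
move=> f g; apply/funext => n.
by rewrite (fps_mul_coef_poly _ _ (ltnSn n)) mulrC -fps_mul_coef_poly.
Qed.

Lemma fps_mulA : associative fps_mul.
Proof.
have truncf (f : fps R) m : \poly_(i < m) (\poly_(i < m) f i)`_i =
    \poly_(i < m) f i.
  by apply/polyP => i; rewrite !coef_poly; case: ltnP => //.
move=> f g h; apply/funext => n.
rewrite !(fps_mul_coef_poly _ _ (ltnSn n)) !fps_mul_poly.
rewrite -{1}(truncf f) -{2}(truncf h) !coefM_poly_trunc //.
by rewrite mulrA.
Qed.

Lemma fps_mul1 : left_id fps_one fps_mul.
Proof.
move=> f; apply/funext => n; rewrite /fps_mul big_ord_recl /= subn0 mul1r.
by rewrite big1 ?addr0 // => i _; rewrite /fps_one mul0r.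
Qed.

Lemma fps_mulDl : left_distributive fps_mul +%R.
Proof.
move=> f g h; apply/funext => n; rewrite /fps_mul /= -[RHS]big_split /=.
by apply: eq_bigr => i _; rewrite -mulrDl.
Qed.

Lemma fps_one_neq0 : fps_one != 0.
Proof.
apply/eqP => /(congr1 (fun f : fps R => f 0%N)) /eqP.
by rewrite /fps_one oner_eq0.
Qed.

HB.instance Definition _ := GRing.Zmodule_isComNzRing.Build (fps R)
  fps_mulA fps_mulC fps_mul1 fps_mulDl fps_one_neq0.

Lemma fpsM f g n : (f * g) n = \sum_(i < n.+1) f i * g (n - i)%N.
Proof. by []. Qed.

Lemma fps1 n : (1 : fps R) n = (n == 0%N)%:R.
Proof. by []. Qed.

Lemma fpsD f g n : (f + g) n = f n + g n. Proof. by []. Qed.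

Lemma fpsN f n : (- f) n = - f n. Proof. by []. Qed.

Lemma fpsMn f k n : (f *+ k) n = f n *+ k.
Proof. by elim: k => [|k IH] //; rewrite !mulrS fpsD IH. Qed.

Lemma fps_natrM f k n : (k%:R * f) n = k%:R * f n.
Proof. by rewrite !mulr_natl fpsMn. Qed.

Lemma fps_nat k n : (k%:R : fps R) n = (n == 0%N)%:R *+ k.
Proof. by rewrite fpsMn fps1. Qed.

Definition fps_var : fps R := fun n => (n == 1%N)%:R.

Lemma fps_varM f n : (fps_var * f) n = if n is m.+1 then f m else 0.
Proof.
rewrite fpsM; case: n => [|n]; first by rewrite big_ord1 mul0r.
rewrite big_ord_recl /= {1}/fps_var mul0r add0r big_ord_recl /= /bump /=.
by rewrite {1}/fps_var mul1r subSS subn0 big1 ?addr0 // => i _; rewrite mul0r.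
Qed.

(** The lowest nonzero coefficient of [f] multiplies the lowest nonzero
coefficient of [g]. *)
Lemma fps_mulf_eq0 f g : f * g = 0 -> f <> 0 -> g = 0.
Proof.
move=> fg0 fn0.
have [i fi] : exists i, f i != 0.
  apply: contrapT => nf; apply: fn0; apply/funext => i; apply/eqP.
  by apply: contrapT => fi; apply: nf; exists i; apply/negP.
case: (ex_minnP (ex_intro (fun i => f i != 0) i fi)) => m fm mmin.
apply/funext; elim/ltn_ind => n IH.
have := congr1 (fun h : fps R => h (m + n)%N) fg0.
rewrite fpsM (bigD1 (inord m)) //= inordK ?ltnS ?leq_addr // addKn.
rewrite big1 => [|j jm].
  by rewrite addr0 => /eqP; rewrite mulf_eq0 (negbTE fm) => /eqP.
have {jm} : (j : nat) != m.
  by apply: contra jm => /eqP jm; rewrite -val_eqE /= inordK ?ltnS ?leq_addr // jm.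
rewrite neq_ltn => /orP[jm|mj].
  by have [->|/mmin] := eqVneq (f j) 0; rewrite ?mul0r // leqNgt jm.
rewrite [g _]IH ?mulr0 //.
by have := ltn_ord j; lia.
Qed.

Lemma fps_mulfI f g h : f <> 0 -> f * g = f * h -> g = h.
Proof.
move=> f0 /eqP; rewrite -subr_eq0 -mulrBr => /eqP /fps_mulf_eq0 /(_ f0) /eqP.
by rewrite subr_eq0 => /eqP.
Qed.

Lemma fps_neq0 f n : f n != 0 -> f <> 0.
Proof. by move=> fn f0; move: fn; rewrite f0 eqxx. Qed.

(** The substitution of [r y] for [y]. *)
Definition fps_scale (r : R) f : fps R := fun n => r ^+ n * f n.

Lemma fps_scaleM r f g : fps_scale r (f * g) = fps_scale r f * fps_scale r g.
Proof.
apply/funext => n; rewrite fpsM /fps_scale fpsM mulr_sumr; apply: eq_bigr => i _.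
by rewrite mulrACA -exprD subnKC // -ltnS.
Qed.

Lemma fps_scaleD r f g : fps_scale r (f + g) = fps_scale r f + fps_scale r g.
Proof. by apply/funext => n; rewrite /fps_scale fpsD mulrDr. Qed.

Lemma fps_scaleN r f : fps_scale r (- f) = - fps_scale r f.
Proof. by apply/funext => n; rewrite /fps_scale fpsN mulrN. Qed.

Lemma fps_scale_nat r k : fps_scale r k%:R = k%:R.
Proof.
apply/funext => n; rewrite /fps_scale fps_nat; case: n => [|n].
  by rewrite mul1r.
by rewrite mul0rn mulr0.
Qed.

Lemma fps_scaleK r s f : fps_scale r (fps_scale s f) = fps_scale (r * s) f.
Proof. by apply/funext => n; rewrite /fps_scale mulrA exprMn. Qed.

End FpsRing.
Arguments fps_var {R}.

(** * Hyperbolic series and the Bernoulli numbers *)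

Section Even.
Variable R : realType.
Implicit Types f g : fps R.

(** For an even series, the series in the square of the variable. *)
Definition fps_even f : fps R := fun n => f (2 * n)%N.

Lemma fps_evenM f g : (forall n, odd n -> f n = 0) ->
  fps_even (f * g) = fps_even f * fps_even g.
Proof.
move=> fodd; apply/funext => n; rewrite /fps_even !fpsM.
rewrite -(big_mkord predT (fun i => f i * g (2 * n - i)%N)).
rewrite -[RHS](big_mkord predT (fun i => f (2 * i)%N * g (2 * (n - i))%N)).
rewrite big_nat_recr //= [RHS]big_nat_recr //= !subnn; congr (_ + _).
suff pairs m : \sum_(0 <= i < 2 * m) f i * g (2 * n - i)%N =
    \sum_(0 <= i < m) f (2 * i)%N * g (2 * (n - i))%N by rewrite pairs.
elim: m => [|m IH]; first by rewrite muln0 !big_nil.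
rewrite mulnS !addSn add0n !big_nat_recr //= IH.
by rewrite [f (2 * m).+1]fodd ?mul0r ?addr0 ?mulnBr //= mul2n odd_double.
Qed.

Definition fps_exp (a : R) : fps R := fun n => a ^+ n / n`!%:R.

Lemma fps_expD (a b : R) : fps_exp (a + b) = fps_exp a * fps_exp b.
Proof.
apply/funext => n; rewrite fpsM /fps_exp addrC exprDn mulr_suml.
apply: eq_bigr => i _; have ni : (i <= n)%N by rewrite -ltnS.
have f0 k : k`!%:R != 0 :> R by rewrite pnatr_eq0 -lt0n fact_gt0.
have := congr1 (fun k => k%:R : R) (bin_fact ni); rewrite !natrM => <-.
rewrite -mulr_natr; field.
by rewrite !f0 pnatr_eq0 -lt0n bin_gt0 ni.
Qed.

Lemma fps_exp0 : fps_exp 0 = 1.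
Proof.
by apply/funext => -[|n]; rewrite /fps_exp fps1 /= ?divr1 // expr0n mul0r.
Qed.

Lemma fps_scale_exp r a : fps_scale r (fps_exp a) = fps_exp (r * a).
Proof. by apply/funext => n; rewrite /fps_scale /fps_exp mulrA exprMn. Qed.

(** The series of [sinh x / x] for [x = sqrt y / 2]. *)
Definition sinhc_half : fps R := fun n => 4^-1 ^+ n / (2 * n).+1`!%:R.

(** The series of [cosh x] for [x = sqrt y / 2]. *)
Definition cosh_half : fps R := fun n => 4^-1 ^+ n / (2 * n)`!%:R.

Let half_even n : (2^-1 : R) ^+ (2 * n) = 4^-1 ^+ n.
Proof. by rewrite exprM; congr (_ ^+ _); rewrite exprVn -natrX. Qed.

(** With [b = t / (e^t - 1)], the series [b + t/2] is [(t/2) coth (t/2)]. It is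
even, and replacing [t] by [2t] and subtracting gives [(t/2) tanh (t/2)]; this
is where the factors [4^(k+1) - 1] come from. *)
Lemma bernoulli_coth_tanh (b : fps R) : b * expm1_coeff R = 1 ->
  fps_even b * sinhc_half = cosh_half /\
  4%:R * ((fun n => (4 ^+ n.+1 - 1) * b (2 * n + 2)%N) : fps R) * cosh_half = sinhc_half.
Proof.
move=> bc; pose t : fps R := fps_var.
(* u = e^(t/2), v = e^(-t/2), and D = 2b + t is t coth (t/2). *)
pose u := fps_exp 2^-1; pose v := fps_exp (- 2^-1); pose D := 2%:R * b + t.
have uv : u * v = 1 by rewrite /u /v -fps_expD subrr fps_exp0.
have tc : t * expm1_coeff R = u * u - 1.
  rewrite -fps_expD (_ : 2^-1 + 2^-1 = 1) //; last by field.
  apply/funext => n; rewrite fpsD fpsN fps_varM fps1 /fps_exp /expm1_coeff.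
  by case: n => [|n]; rewrite expr1n div1r ?invr1 ?subrr // subr0.
have Duv : D * (u - v) = t * (u + v).
  have -> : D * (u - v) = D * v * (u * u - 1) - D * u * (u * v - 1) by ring.
  rewrite uv subrr mulr0 subr0 -tc.
  have -> : D * v * (t * expm1_coeff R) =
      v * (2%:R * t * (b * expm1_coeff R) + t * (t * expm1_coeff R)).
    by rewrite /D; ring.
  rewrite bc tc.
  have -> : v * (2%:R * t * 1 + t * (u * u - 1)) = t * (v + (u * v) * u) by ring.
  by rewrite uv mul1r addrC.
(* u - v = 2 sinh (t/2) and u + v = 2 cosh (t/2). *)
pose Sh : fps R := fun n => if odd n then 0 else 2^-1 ^+ n / (n.+1)`!%:R.
pose Ch : fps R := fun n => if odd n then 0 else 2^-1 ^+ n / n`!%:R.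
have uvS : u - v = t * Sh.
  apply/funext => n; rewrite fps_varM fpsD fpsN /u /v /fps_exp.
  case: n => [|n]; first by rewrite subrr.
  rewrite /Sh exprNn -signr_odd /=; case: (odd n) => /=.
    by rewrite expr0 mul1r subrr.
  by rewrite expr1 exprS; field; rewrite pnatr_eq0 -lt0n fact_gt0.
have uvC : u + v = 2%:R * Ch.
  apply/funext => n; rewrite fps_natrM fpsD /u /v /fps_exp.
  rewrite /Ch exprNn -signr_odd /=; case: (odd n) => /=; last first.
    by rewrite expr0 mul1r; ring.
  by rewrite expr1; ring.
have t0 : t <> 0 by apply: (@fps_neq0 _ _ 1); rewrite /t /fps_var oner_eq0.
have uv0 : u - v <> 0.
  rewrite uvS; apply: (@fps_neq0 _ _ 1); rewrite fps_varM /Sh /= expr0 divr1.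
  by rewrite oner_eq0.
have st r : fps_scale r t = (fun n => (n == 1)%:R * r).
  by apply/funext => -[|[|n]]; rewrite /fps_scale ?mulr0 ?mul0r // mulr1 mul1r.
(* The equation Duv is invariant under t |-> -t, so D is even. *)
have Dodd n : odd n -> D n = 0.
  have sD : fps_scale (-1) D = D.
    apply: (fps_mulfI uv0).
    have := congr1 (fps_scale (-1)) Duv.
    rewrite [LHS]fps_scaleM [fps_scale _ (t * _)]fps_scaleM.
    rewrite !(fps_scaleD _ u) fps_scaleN.
    have -> : fps_scale (-1) t = - t.
      by rewrite st; apply/funext => k; rewrite fpsN mulrN1.
    rewrite !fps_scale_exp !mulN1r opprK -/u -/v => sDuv.
    rewrite [RHS]mulrC Duv.
    have -> : (u - v) * fps_scale (-1) D = - (fps_scale (-1) D * (v - u)).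
      by ring.
    by rewrite sDuv; ring.
  move=> on; have := congr1 (fun f => f n) sD.
  by rewrite /fps_scale -signr_odd on expr1 mulN1r; lra.
have DS : D * Sh = 2%:R * Ch.
  apply: (fps_mulfI t0); rewrite mulrCA -uvS Duv uvC; ring.
(* coth 2x - (coth x) / 2 = (tanh x) / 2, after multiplication by 4x. *)
have D2 : (fps_scale 2 D - D) * (u + v) = t * (u - v).
  apply: (fps_mulfI uv0).
  have := congr1 (fps_scale 2) Duv.
  rewrite [LHS]fps_scaleM [fps_scale _ (t * _)]fps_scaleM.
  rewrite !(fps_scaleD _ u) fps_scaleN.
  have -> : fps_scale 2 t = 2%:R * t.
    by rewrite st; apply/funext => n; rewrite fps_natrM mulrC.
  rewrite !fps_scale_exp mulrN (_ : 2 * 2^-1 = 2^-1 + 2^-1); last by field.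
  rewrite opprD !fps_expD -/u -/v => D2uv.
  have -> : (u - v) * ((fps_scale 2 D - D) * (u + v)) =
    fps_scale 2 D * (u * u - v * v) - (D * (u - v)) * (u + v) by ring.
  by rewrite D2uv Duv; ring.
pose T : fps R := fun n => if odd n then 0 else 2 * (2 ^+ (n.+2) - 1) * b n.+2.
have D2T : fps_scale 2 D - D = t * (t * T).
  have tt m : (t * (t * T)) m = if m is m'.+2 then T m' else 0.
    by case: m => [|[|m]]; rewrite fps_varM // fps_varM.
  apply/funext => n; rewrite tt fpsD fpsN.
  have [on|en] := boolP (odd n).
    rewrite /fps_scale Dodd // mulr0 subrr.
    by case: n on => [|[|n]] //=; rewrite negbK /T => ->.
  case: n en => [|[|n]] //; first by rewrite /fps_scale expr0 mul1r subrr.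
  rewrite /= negbK /T => /negbTE ->.
  rewrite /fps_scale /D fpsD fps_natrM /t /fps_var /= addr0; ring.
have TC : 2%:R * T * Ch = Sh.
  apply: (fps_mulfI t0); apply: (fps_mulfI t0).
  by rewrite -uvS -D2 D2T uvC; ring.
have eSh : fps_even Sh = sinhc_half.
  apply/funext => n.
  by rewrite /fps_even /Sh mul2n odd_double /sinhc_half -mul2n half_even.
have eCh : fps_even Ch = cosh_half.
  apply/funext => n.
  by rewrite /fps_even /Ch mul2n odd_double /cosh_half -mul2n half_even.
have n20 : (2%:R : fps R) <> 0.
  by apply: (@fps_neq0 _ _ 0); rewrite fps_nat /= pnatr_eq0.
have even2 f : fps_even (2%:R * f) = 2%:R * fps_even f.
  by apply/funext => n; rewrite fps_natrM /fps_even fps_natrM.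
split.
  have := congr1 fps_even DS; rewrite fps_evenM // even2 eSh eCh => DS'.
  apply: (fps_mulfI n20); rewrite -DS' mulrA; congr (_ * _).
  apply/funext => n; rewrite fps_natrM /fps_even /D fpsD fps_natrM /t /fps_var.
  by rewrite (_ : (2 * n == 1)%N = false) ?addr0 //; lia.
have := congr1 fps_even TC; rewrite -mulrA even2 fps_evenM => [|n on]; last first.
  by rewrite /T on.
rewrite eSh eCh => <-; rewrite mulrA; congr (_ * _).
apply/funext => n; rewrite !fps_natrM /fps_even /T mul2n odd_double.
rewrite -mul2n addn2.
have -> : (2 : R) ^+ (2 * n).+2 = 4 ^+ n.+1.
  have -> : (2 * n).+2 = (2 * n.+1)%N by lia.
  by rewrite exprM; congr (_ ^+ _); rewrite -natrX.
by ring.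
Qed.

End Even.

(** * Truncated star sums and the kernel identity *)

Section Kernel.
Variable R : realType.

(** The star sum restricted to [n >= k_1], computed from the outermost index. *)
Fixpoint star_sum (s : seq nat) (n : nat) : R :=
  if s is a :: s' then \sum_(k < n) k.+1%:R ^- a * star_sum s' k.+1 else 1.

(** This is [n!^2 / ((n-l)! (n+l)!)], written as a product that vanishes for
[l > n]. *)
Definition kernel n l : R := \prod_(i < l) ((n%:R - i%:R) / (n + i.+1)%:R).

Lemma kernel0 n : kernel n 0 = 1.
Proof. by rewrite /kernel big_ord0. Qed.

Lemma kernelS n l :
  (n + l.+1)%:R * kernel n l.+1 = (n%:R - l%:R) * kernel n l.
Proof.
rewrite /kernel big_ord_recr /= mulrCA [RHS]mulrC; congr (_ * _).
by rewrite mulrC divfK // pnatr_eq0 addnS.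
Qed.

Lemma kernel_gt n l : (n < l)%N -> kernel n l = 0.
Proof.
move=> nl; rewrite /kernel (bigD1 (Ordinal nl)) //= subrr mul0r mul0r //.
Qed.

Lemma kernel_ge0 n l : 0 <= kernel n l.
Proof.
have [ln|nl] := leqP l n; last by rewrite kernel_gt.
apply: prodr_ge0 => i _; rewrite divr_ge0 // subr_ge0 ler_nat.
by rewrite (leq_trans _ ln) // ltnW.
Qed.

Lemma kernel_le1 n l : kernel n l <= 1.
Proof.
have [ln|nl] := leqP l n; last by rewrite kernel_gt.
apply: prodr_ile1 => i _; have iR : i%:R <= n%:R :> R.
  by rewrite ler_nat (leq_trans _ ln) // ltnW.
have i0 : 0 <= i%:R :> R by [].
rewrite divr_ge0 ?subr_ge0 //= ler_pdivrMr ?ltr0n ?addnS // mul1r -addnS natrD.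
by rewrite -natr1; lra.
Qed.

(** A summation of the kernel over [n] with weight [1 / n^2] is thus a division
by [l^2] on the other side of the kernel. *)
Lemma kernel_sub n l : n.+1%:R ^+ 2 * (kernel n.+1 l - kernel n l) =
  l%:R ^+ 2 * kernel n.+1 l.
Proof.
elim: l => [|l IH]; first by rewrite !kernel0; ring.
have d1 : (n + l.+1)%:R != 0 :> R by rewrite pnatr_eq0 addnS.
have d2 : (n.+1 + l.+1)%:R != 0 :> R by rewrite pnatr_eq0 addnS.
have := kernelS n l; have := kernelS n.+1 l; move: IH d1 d2.
rewrite !natrD -!(natr1 l) -!(natr1 n).
move: (kernel _ l) (kernel _ l.+1) (kernel n l) (kernel n l.+1) => x x' y y'.
move: (n%:R : R) (l%:R : R) => N L IH d1 d2 ex ey.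
apply: (mulfI (mulf_neq0 d1 d2)).
have -> : (N + (L + 1)) * (N + 1 + (L + 1)) *
    ((N + 1) ^+ 2 * (x' - y')) =
  (N + 1) ^+ 2 * ((N + (L + 1)) * ((N + 1 + (L + 1)) * x') -
  (N + 1 + (L + 1)) * ((N + (L + 1)) * y')) by ring.
have -> : (N + (L + 1)) * (N + 1 + (L + 1)) * ((L + 1) ^+ 2 * x') =
  (N + (L + 1)) * (L + 1) ^+ 2 * ((N + 1 + (L + 1)) * x') by ring.
rewrite ex ey; apply/eqP; rewrite -subr_eq0; apply/eqP.
transitivity ((N + 1 + (L+1)) * (N - L) * ((N+1) ^+2 * (x - y) - L ^+ 2 * x)).
  ring.
by rewrite IH subrr mulr0.
Qed.

(** This relation, with summation by parts in [l], converts a factor [1 / n]. *)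
Lemma kernel_diff n l : n%:R * (kernel n l - kernel n l.+1) =
  l%:R * kernel n l + l.+1%:R * kernel n l.+1.
Proof. by have := kernelS n l; rewrite natrD; lra. Qed.

(** Summation by parts is the case [e = -1]; the case [e = 1] is its analogue
for sums of consecutive terms. *)
Lemma sum_parts (e : R) (d g : nat -> R) n : d n.+1 = 0 ->
  \sum_(l < n.+1) (d l + e * d l.+1) * g l =
  d 0%N * g 0%N + \sum_(l < n) d l.+1 * (g l.+1 + e * g l).
Proof.
move=> dn; under eq_bigr do rewrite mulrDl.
rewrite big_split big_ord_recl /= -addrA; congr (_ + _).
rewrite big_ord_recr /= dn mulr0 mul0r addr0 -big_split; apply: eq_bigr => l _.
by rewrite /bump /= add1n; ring.
Qed.

(** [rho N l] is the coefficient of [y^N] in the product over [1 <= k <= l] of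
[(1 - (-1)^k y / k^2) / (1 + (-1)^k y / k^2)]. Cross-multiplying the quotient of
two consecutive products gives the difference [rhoS], and summing it over [l]
gives this definition. *)
Fixpoint rho (N : nat) : nat -> R :=
  if N is M.+1 then
    fun l => \sum_(k < l) (-1) ^+ k / k.+1%:R ^+ 2 * (rho M k.+1 + rho M k)
  else fun=> 1.

Lemma rhoS N l : rho N.+1 l.+1 - rho N.+1 l =
  (-1) ^+ l / l.+1%:R ^+ 2 * (rho N l.+1 + rho N l).
Proof. by rewrite /= big_ord_recr /= addrAC subrr add0r. Qed.

Lemma rho0 N : rho N 0 = (N == 0)%:R.
Proof. by case: N => //= N; rewrite big_ord0. Qed.

(** An average of the values of [g], see [kernel_mean_const1]. *)
Definition kernel_mean (g : nat -> R) n : R :=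
  \sum_(l < n.+1) (kernel n l - kernel n l.+1) * g l.

(** For [g = rho N] this is the star sum with an additional outermost exponent
1, see [star_sum_index]. *)
Definition kernel_sum (g : nat -> R) n : R :=
  \sum_(l < n) kernel n l.+1 / l.+1%:R * (g l.+1 + g l).

Lemma kernel_mean_parts g n :
  kernel_mean g n = g 0%N + \sum_(l < n) kernel n l.+1 * (g l.+1 - g l).
Proof.
have := sum_parts (-1) g (kernel_gt (ltnSn n)); rewrite kernel0 mul1r => E.
transitivity (\sum_(l < n.+1) (kernel n l + -1 * kernel n l.+1) * g l).
  by apply: eq_bigr => l _; rewrite mulN1r.
by rewrite E; congr (_ + _); apply: eq_bigr => l _; rewrite mulN1r.
Qed.

Lemma kernel_meanE g n : n%:R * kernel_mean g n =
  \sum_(l < n) l.+1%:R * kernel n l.+1 * (g l.+1 + g l).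
Proof.
have := sum_parts 1 g (d := fun l => l%:R * kernel n l) (n := n).
rewrite kernel_gt // mulr0 !mul0r add0r => /(_ erefl) E.
rewrite mulr_sumr; transitivity (\sum_(l < n.+1)
    (l%:R * kernel n l + 1 * (l.+1%:R * kernel n l.+1)) * g l).
  by apply: eq_bigr => l _; rewrite mulrA kernel_diff mul1r.
by rewrite E; apply: eq_bigr => l _; rewrite mul1r.
Qed.

Let S_neq0 n : n.+1%:R != 0 :> R. Proof. by rewrite pnatr_eq0. Qed.

Lemma sum_kernel_sub (g : nat -> R) n :
  \sum_(l < n.+1) kernel n.+1 l.+1 * g l - \sum_(l < n) kernel n l.+1 * g l =
  n.+1%:R ^- 2 * \sum_(l < n.+1) l.+1%:R ^+ 2 * kernel n.+1 l.+1 * g l.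
Proof.
have -> : \sum_(l < n) kernel n l.+1 * g l = \sum_(l < n.+1) kernel n l.+1 * g l.
  by rewrite [RHS]big_ord_recr /= kernel_gt // mul0r addr0.
rewrite -sumrB mulr_sumr; apply: eq_bigr => l _; rewrite -kernel_sub.
by rewrite -mulrA mulKf ?expf_neq0 // mulrBl.
Qed.

(** Mirrors the recurrence in [n] of a star sum with outermost exponent 1. *)
Lemma kernel_sumS g n :
  kernel_sum g n.+1 - kernel_sum g n = n.+1%:R^-1 * kernel_mean g n.+1.
Proof.
have sumE m : kernel_sum g m =
    \sum_(l < m) kernel m l.+1 * (l.+1%:R^-1 * (g l.+1 + g l)).
  by apply: eq_bigr => l _; rewrite mulrA.
rewrite !sumE (sum_kernel_sub (fun l => l.+1%:R^-1 * (g l.+1 + g l))).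
rewrite -[kernel_mean _ _](mulKf (S_neq0 n)) kernel_meanE mulrA -invfM -expr2.
by congr (_ * _); apply: eq_bigr => l _; field; rewrite nat1r S_neq0.
Qed.

(** Mirrors the recurrence in [n] of a star sum with outermost exponent 3
followed by 1, or, for the coefficient of [y], with the single exponent 2. In
[rhoS] the sign [(-1)^l] turns a difference of consecutive [rho] into a sum, so
after twisting [rho] by this sign a second summation by parts applies. *)
Lemma kernel_mean_rhoS N n :
  kernel_mean (rho N.+1) n.+1 - kernel_mean (rho N.+1) n =
  n.+1%:R ^- 2 * (if N is M.+1 then n.+1%:R^-1 * kernel_sum (rho M) n.+1 else 1).
Proof.
pose s l := (-1) ^+ l * rho N l.
rewrite !kernel_mean_parts opprD addrACA subrr add0r.
rewrite (sum_kernel_sub (fun l => rho N.+1 l.+1 - rho N.+1 l)); congr (_ * _).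
have -> : \sum_(l < n.+1) l.+1%:R ^+ 2 * kernel n.+1 l.+1 *
    (rho N.+1 l.+1 - rho N.+1 l) = rho N 0 - kernel_mean s n.+1.
  rewrite kernel_mean_parts {1}/s expr0 mul1r opprD addrA subrr sub0r -sumrN.
  apply: eq_bigr => l _; rewrite rhoS /s [(-1) ^+ l.+1]exprS; field.
  by rewrite nat1r S_neq0.
rewrite -[kernel_mean _ _](mulKf (S_neq0 n)) kernel_meanE rho0.
case: N @s => [|N] s.
  by rewrite big1 ?mulr0 ?subr0 // => l _; rewrite /s [(-1) ^+ l.+1]exprS /=; ring.
rewrite sub0r -mulrN; congr (_ * _); rewrite -sumrN; apply: eq_bigr => l _.
have -> : s l.+1 + s l = - ((-1) ^+ l * (rho N.+1 l.+1 - rho N.+1 l)).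
  by rewrite /s [(-1) ^+ l.+1]exprS; ring.
rewrite rhoS mulrA (mulrA (_ ^+ l)) -expr2 sqrr_sign.
by field; rewrite nat1r S_neq0.
Qed.

End Kernel.

(** * Multiple zeta star values as limits of truncated sums *)

Section ZetaStar.
Variable R : realType.

Definition star_term (s k : seq nat) : R :=
  \prod_(i < size s) (nth 0%N k i)%:R ^- nth 0%N s i.

Definition star_box (r n : nat) : set (seq nat) :=
  [set k | star_tuples r k /\ all (geq n) k].

Lemma star_term_cons a s m k :
  star_term (a :: s) (m :: k) = m%:R ^- a * star_term s k.
Proof. by rewrite /star_term big_ord_recl. Qed.

Lemma star_term_ge0 s k : 0 <= star_term s k.
Proof. by apply: prodr_ge0 => i _; rewrite invr_ge0 exprn_ge0. Qed.

Let sorted_cons m k : sorted geq (m :: k) = all (geq m) k && sorted geq k.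
Proof.
by rewrite /= path_sortedE // => a b c /= ba ac; exact: leq_trans ac ba.
Qed.

(** Sorting the tuples by their largest entry. *)
Lemma star_tuplesS r :
  star_tuples r.+1 = \bigcup_(m in setT) (cons m.+1 @` star_box r m.+1).
Proof.
apply/seteqP; split => [[|[|m] k] [] //= [kr] + k1|].
  rewrite -/(sorted geq (_ :: k)) sorted_cons => /andP[km ks].
  by exists m => //; exists k.
move=> k [m _] [k' [[k'r k's k'1] k'm] <-]; split; rewrite ?sorted_cons ?k'm //=.
by rewrite k'r.
Qed.

Lemma star_boxS r n :
  star_box r.+1 n = \bigcup_(m in `I_n) (cons m.+1 @` star_box r m.+1).
Proof.
apply/seteqP; split => k.
  rewrite /star_box /= star_tuplesS => -[[m _ [k' kb <-]]] /= /andP[mn _].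
  by exists m => //; exists k'.
move=> [m /= mn [k' kb <-]]; split.
  by rewrite star_tuplesS; exists m => //; exists k'.
rewrite /= mn /=; case: kb => _; apply: sub_all => x /= xm.
exact: leq_trans xm mn.
Qed.

Lemma esum_cons_cover (K : set nat) a s (c : R)
    (T := \bigcup_(m in K) (cons m.+1 @` star_box (size s) m.+1)) : 0 <= c ->
  \esum_(k in T) (c * star_term (a :: s) k)%:E =
  \esum_(m in K) \esum_(k in star_box (size s) m.+1)
     (c * m.+1%:R ^- a * star_term s k)%:E.
Proof.
move=> c0; rewrite esum_bigcupT; last 2 first.
- by move=> i j _ _ [k [[k1 _ <-] [k2 _ [-> _]]]].
- by move=> k; rewrite lee_fin mulr_ge0 // star_term_ge0.
apply: eq_esum => m _; rewrite esum_image => [|k1 k2 _ _ [] //].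
by apply: eq_esum => k _; rewrite star_term_cons mulrA.
Qed.

Lemma star_sum_ge0 s n : 0 <= star_sum R s n.
Proof.
elim: s n => [|a s IH] n //=; apply: sumr_ge0 => k _.
by rewrite mulr_ge0 // invr_ge0 exprn_ge0.
Qed.

(** The factor [c] makes the induction go through: it collects the powers of
the outer indices. *)
Lemma esum_star_box s n (c : R) : 0 <= c ->
  \esum_(k in star_box (size s) n) (c * star_term s k)%:E =
  (c * star_sum R s n)%:E.
Proof.
elim: s n c => [|a s IH] n c c0.
  have -> : star_box 0 n = [set [::]].
    by apply/seteqP; split => [k [[/size0nil ->]]|k ->].
  by rewrite esum_set1 /star_term big_ord0 // lee_fin mulr1.
rewrite /= star_boxS esum_cons_cover // esum_fset ?finite_II // => [|m _].
  rewrite -fsbig_ord mulr_sumr -sumEFin; apply: eq_bigr => m _.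
  by rewrite IH ?mulrA // mulr_ge0 // invr_ge0 exprn_ge0.
by apply: esum_ge0 => k _; rewrite lee_fin !mulr_ge0 ?star_term_ge0.
Qed.

Lemma zeta_star_cvg s (x : R) : star_sum R s n @[n --> \oo] --> x ->
  zeta_star R s = x%:E.
Proof.
rewrite /zeta_star -/(star_term _ _).
case: s => [|a s] sx.
  have -> : star_tuples 0 = [set [::]].
    by apply/seteqP; split => [k [/size0nil ->]|k ->].
  rewrite esum_set1 big_ord0 ?lee_fin //; congr (_%:E).
  by move/cvg_lim : sx => <- //; rewrite lim_cst.
transitivity (\esum_(k in star_tuples (size s).+1)
   (1 * star_term (a :: s) k)%:E).
  by apply: eq_esum => k _; rewrite mul1r.
rewrite star_tuplesS esum_cons_cover //.
transitivity (\esum_(m in setT) (m.+1%:R ^- a * star_sum R s m.+1)%:E).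
  apply: eq_esum => m _; rewrite mul1r esum_star_box // invr_ge0 exprn_ge0 //.
rewrite -nneseries_esumT => [|m]; last first.
  by rewrite lee_fin mulr_ge0 ?star_sum_ge0 // invr_ge0 exprn_ge0.
apply/cvg_lim => //; apply: cvg_EFin; first by apply: nearW => n; rewrite sumEFin.
apply: (cvg_trans _ sx); apply: near_eq_cvg; near=> n => /=.
by rewrite sumEFin /= big_mkord.
Unshelve. all: by end_near. Qed.

End ZetaStar.

(** * The star sums of the theorem and their limits *)

Section Limit.
Variable R : realType.

(** Enumerating by half the weight merges the two families of the theorem into
one sequence. *)
Fixpoint star_index (N : nat) : seq nat :=
  match N with 0 => [::] | 1 => [:: 2%N] | M.+2 => [:: 3, 1 & star_index M]%N end.

Lemma star_index_even d : star_index (2 * d) = repeat_index d [:: 3; 1]%N.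
Proof. by elim: d => // d IH; rewrite mulnS /= IH. Qed.

Lemma star_index_odd d :
  star_index (2 * d).+1 = repeat_index d [:: 3; 1]%N ++ [:: 2%N].
Proof.
elim: d => // d IH; rewrite mulnS.
by rewrite -[LHS]/[:: 3, 1 & star_index (2 * d).+1]%N IH.
Qed.

Lemma kernel_mean_at0 (g : nat -> R) : kernel_mean g 0 = g 0%N.
Proof.
by rewrite /kernel_mean big_ord1 kernel0 (@kernel_gt _ 0 1) // subr0 mul1r.
Qed.

Lemma kernel_mean_const1 n : kernel_mean (fun=> 1 : R) n = 1.
Proof.
by rewrite kernel_mean_parts big1 ?addr0 // => l _; rewrite subrr mulr0.
Qed.

Lemma star_sumS a s n : star_sum R (a :: s) n.+1 =
  star_sum R (a :: s) n + n.+1%:R ^- a * star_sum R s n.+1.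
Proof. by rewrite /= big_ord_recr. Qed.

(** Both sides have the same value at [n = 0] and the same increments; the index
grows by [3, 1] when [N] grows by 2. *)
Lemma star_sum_index N n : star_sum R (star_index N) n = kernel_mean (rho R N) n.
Proof.
have one_cons M : (forall n, star_sum R (star_index M) n =
      kernel_mean (rho R M) n) ->
    forall n, star_sum R (1%N :: star_index M) n = kernel_sum (rho R M) n.
  move=> HM; elim=> [|m IH]; first by rewrite /= /kernel_sum !big_ord0.
  rewrite star_sumS IH HM expr1 -kernel_sumS addrC subrK //.
elim/ltn_ind: N n => -[|[|N]] IHN n.
- by rewrite kernel_mean_const1.
- elim: n => [|n IH]; first by rewrite kernel_mean_at0 rho0 /= big_ord0.
  rewrite [star_index 1]/= star_sumS [star_sum _ _ n]IH.
  by rewrite -[X in _ + X](kernel_mean_rhoS R 0) addrC subrK.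
- elim: n => [|n IH]; first by rewrite kernel_mean_at0 rho0 /= big_ord0.
  rewrite [star_index N.+2]/= star_sumS [star_sum _ _ n]IH.
  rewrite one_cons => [|m]; last by rewrite IHN.
  have := kernel_mean_rhoS R N.+1 n; rewrite mulrA -invfM -exprSr => <-.
  by rewrite addrC subrK.
Qed.

Lemma kernel_weight_ge0 n l : 0 <= kernel R n l - kernel R n l.+1.
Proof.
have p : 0 < (n + l.+1)%:R :> R by rewrite ltr0n addnS.
rewrite subr_ge0 -(ler_pM2l p) kernelS ler_wpM2r ?kernel_ge0 // natrD -natr1.
by have : 0 <= l%:R :> R by []; lra.
Qed.

Lemma kernel_weight_le n l :
  kernel R n l - kernel R n l.+1 <= (2 * l).+1%:R / n.+1%:R.
Proof.
rewrite ler_pdivlMr ?ltr0n //.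
have := kernelS R n l; have := kernel_le1 R n l; have := kernel_ge0 R n l.
have := kernel_weight_ge0 n l.
rewrite -[(2 * l).+1%:R]natr1 -[n.+1%:R]natr1 natrM natrD -[l.+1%:R]natr1.
have : 0 <= l%:R :> R by [].
move: (kernel R n l) (kernel R n l.+1) (n%:R : R) (l%:R : R).
move=> x y N L L0 yx x0 x1 xy.
have -> : (x - y) * (N + 1) = (2 * L + 1) * x - L * (x - y).
  have -> : (x - y) * (N + 1) = (N + 1) * x + L * y - (N + (L + 1)) * y by ring.
  by rewrite xy; ring.
have : 0 <= L * (x - y) by exact: mulr_ge0.
have : (2 * L + 1) * x <= 2 * L + 1 by apply: ler_piMr => //; lra.
lra.
Qed.

(** A regular summation method: the weights are nonnegative with sum 1, and each
is at most [(2l+1) / (n+1)], so any finite set of indices is negligible. *)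
Lemma kernel_mean_cvg (g : nat -> R) (x : R) :
  g @ \oo --> x -> kernel_mean g @ \oo --> x.
Proof.
move=> gx; apply/cvgrPdist_le => e e0.
have /cvgrPdist_le/(_ (e / 2)) := gx.
rewrite divr_gt0 // => /(_ isT)[K _ gK].
pose D := \sum_(l < K) (2 * l).+1%:R * `|x - g l|.
have D0 : (D * harmonic n) @[n --> \oo] --> (0 : R).
  by rewrite -(mulr0 D); apply: cvgMl_tmp; exact: cvg_harmonic.
have /cvgrPdist_le/(_ (e / 2)) := D0; rewrite divr_gt0 // => /(_ isT) De.
near=> n.
have Kn : (K <= n.+1)%N by rewrite ltnW // ltnS; near: n; exists K.
have -> : x - kernel_mean g n =
    \sum_(l < n.+1) (kernel R n l - kernel R n l.+1) * (x - g l).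
  rewrite -{1}[x]mul1r -(kernel_mean_const1 n) /kernel_mean mulr_suml -sumrB.
  by apply: eq_bigr => l _; ring.
apply: (le_trans (ler_norm_sum _ _ _)).
apply: (@le_trans _ _ (\sum_(l < n.+1)
   ((kernel R n l - kernel R n l.+1) * (e / 2) +
    if (l < K)%N then (2 * l).+1%:R / n.+1%:R * `|x - g l| else 0))).
  apply: ler_sum => l _; rewrite normrM (ger0_norm (kernel_weight_ge0 _ _)).
  case: ltnP => lK.
    apply: ler_wpDl; first by rewrite mulr_ge0 ?kernel_weight_ge0 // ltW ?divr_gt0.
    by rewrite ler_wpM2r // kernel_weight_le.
  by rewrite addr0 ler_wpM2l ?kernel_weight_ge0 //; apply: gK.
rewrite big_split -mulr_suml /=.
have -> : \sum_(l < n.+1) (kernel R n l - kernel R n l.+1) = 1.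
  rewrite -[RHS](kernel_mean_const1 n).
  by apply: eq_bigr => l _; rewrite mulr1.
rewrite -big_mkcond -(big_ord_widen _ (fun l => (2 * l).+1%:R / n.+1%:R * `|x - g l|)) //.
have -> : \sum_(l < K) (2 * l).+1%:R / n.+1%:R * `|x - g l| = D * harmonic n.
  by rewrite mulr_suml; apply: eq_bigr => l _; rewrite mulrAC.
have : `|0 - D * harmonic n| <= e / 2 by near: n.
rewrite sub0r normrN => /(le_trans (ler_norm _)); lra.
Unshelve. all: by end_near. Qed.

(** The partial sums are bounded by the telescoping sums of
[2 / ((k+1)(k+2))]. *)
Lemma is_cvg_series_inv_sqr : cvgn (series (fun k => (k.+1%:R ^+ 2)^-1 : R)).
Proof.
apply: nondecreasing_is_cvgn.
  by apply: nondecreasing_series => k _ _; rewrite invr_ge0 exprn_ge0.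
exists 2 => _ [n _ <-]; rewrite /series /= big_mkord.
suff : \sum_(k < n) (k.+1%:R ^+ 2)^-1 <= 2 - 2 / n.+1%:R :> R.
  by move/le_trans; apply; rewrite lerBlDr lerDl divr_ge0.
elim: n => [|n IH]; first by rewrite big_ord0 divr1 subrr.
rewrite big_ord_recr /=; apply: (le_trans (lerD IH (lexx _))).
rewrite -[n.+2%:R]natr1 -[n.+1%:R]natr1; have n0 : 0 <= n%:R :> R by [].
move: (n%:R : R) n0 => x x0.
rewrite -subr_ge0.
have -> : 2 - 2 / (x + 1 + 1) - (2 - 2 / (x + 1) + ((x + 1) ^+ 2)^-1) =
    x / ((x + 1) ^+ 2 * (x + 2)).
  by field; rewrite !gt_eqF //; lra.
by rewrite divr_ge0 // mulr_ge0 ?exprn_ge0 //; lra.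
Qed.

Lemma rho_is_cvg N : cvgn (rho R N).
Proof.
elim: N => [|N IH]; first exact: is_cvg_cst.
have [M HM] := cvg_has_ub IH.
have rhoM k : `|rho R N k| <= M by apply: HM; exists k.
pose u k := (-1) ^+ k / k.+1%:R ^+ 2 * (rho R N k.+1 + rho R N k).
have -> : rho R N.+1 = series u.
  by apply/funext => l; rewrite /series /= big_mkord.
apply: normed_cvg; apply: (@series_le_cvg _ _ (fun k => 2 * M * (k.+1%:R ^+ 2)^-1)).
- by move=> k; exact: normr_ge0.
- move=> k; rewrite mulr_ge0 ?invr_ge0 ?exprn_ge0 // mulr_ge0 //.
  exact: le_trans (rhoM 0%N).
- move=> k; rewrite /u /= !normrM normrX normrN1 expr1n mul1r normfV.
  rewrite [`|_ ^+ 2|]ger0_norm ?exprn_ge0 // mulrC ler_wpM2r ?invr_ge0 ?exprn_ge0 //.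
  apply: (le_trans (ler_normD _ _)).
  by rewrite (mulr_natl M 2) mulr2n lerD.
- exact: (@is_cvg_seriesZ _ _ (2 * M) is_cvg_series_inv_sqr).
Qed.

End Limit.

(** * Integrals of t^m cos^n t over a quarter period *)

Section Wallis.
Variable R : realType.
Local Notation mu := lebesgue_measure.

Definition powfact (m : nat) (t : R) : R := t ^+ m / m`!%:R.

Definition int_pihalf (f : R -> R) : R := \int[mu]_(t in `[0, pi / 2]) f t.

(* Found by the automation when it solves the hypothesis 0 < pi / 2. *)
Let pihalf_gt0 : 0 < pi / 2 :> R. Proof. by rewrite divr_gt0 ?pi_gt0. Qed.

Lemma int_pihalf_integrable (f : R -> R) : continuous f ->
  mu.-integrable `[0, pi / 2] (EFin \o f).
Proof.
move=> cf; apply: continuous_compact_integrable; first exact: segment_compact.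
exact: continuous_subspaceT.
Qed.

Lemma int_pihalf_derive (F f : R -> R) : continuous f ->
  (forall t : R, is_derive t (1 : R) F (f t)) -> int_pihalf f = F (pi / 2) - F 0.
Proof.
move=> cf Ff; have cF : continuous F.
  move=> t; apply: differentiable_continuous; apply/derivable1_diffP.
  by have [] := Ff t.
rewrite /int_pihalf /Rintegral (@continuous_FTC2 _ f F) //.
- exact: continuous_subspaceT.
- split=> [t _||]; first by have [] := Ff t.
  + by apply: cvg_at_right_filter; exact: cF.
  + by apply: cvg_at_left_filter; exact: cF.
- by move=> t _; rewrite derive1E; have [_ ->] := Ff t.
Qed.

Lemma int_pihalf_lin (a b : R) (f g : R -> R) : continuous f -> continuous g ->
  int_pihalf (fun t => a * f t + b * g t) = a * int_pihalf f + b * int_pihalf g.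
Proof.
move=> cf cg; have cZ (c : R) (h : R -> R) :
    continuous h -> continuous (fun t => c * h t).
  by move=> ch t; apply: cvgMl_tmp; exact: ch.
rewrite /int_pihalf RintegralD //; try exact: int_pihalf_integrable (cZ _ _ _).
by rewrite !RintegralZl //; exact: int_pihalf_integrable.
Qed.

Lemma int_pihalf_le (f g : R -> R) : continuous f -> continuous g ->
  (forall t, 0 <= t <= pi / 2 -> f t <= g t) -> int_pihalf f <= int_pihalf g.
Proof.
by move=> cf cg fg; apply: le_Rintegral => //; exact: int_pihalf_integrable.
Qed.

#[local] Instance is_derive_powfact m (t : R) :
  is_derive t (1 : R) (powfact m.+1) (powfact m t).
Proof.
have -> : powfact m.+1 = (fun t => (m.+1`!%:R^-1 : R) *: (id ^+ m.+1) t).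
  by apply/funext => s; rewrite /powfact !fctE mulrC.
apply: is_derive_eq => /=; rewrite /powfact factS natrM /GRing.scale /=.
by rewrite mulr1; field; rewrite nat1r !pnatr_eq0 -lt0n fact_gt0.
Qed.

Lemma powfact_continuous m : continuous (powfact m).
Proof. by move=> t; apply: cvgMr_tmp; exact: exprn_continuous. Qed.

Definition powcos m n (t : R) : R := powfact m t * cos t ^+ n.

Lemma powcos_continuous m n : continuous (powcos m n).
Proof.
move=> t; apply: cvgM; first exact: powfact_continuous.
exact: (cvg_comp _ _ (@continuous_cos _ t) (@exprn_continuous _ n _)).
Qed.

Definition wallis m n := int_pihalf (powcos m n).

Let powfact0S m : powfact m.+1 0 = 0.
Proof. by rewrite /powfact expr0n mul0r. Qed.

(** Two integrations by parts, done at once by naming the primitive. *)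
Lemma wallis_rec m k :
  k.+2%:R ^+ 2 * wallis m.+2 k.+2 + wallis m k.+2 = k.+2%:R * k.+1%:R * wallis m.+2 k.
Proof.
pose F : R -> R := (k.+2%:R : R) *: (powfact m.+2 * cos ^+ k.+1 * sin) +
  powfact m.+1 * cos ^+ k.+2.
have dF (t : R) : is_derive t (1 : R) F
    (1 * (k.+2%:R ^+ 2 * powcos m.+2 k.+2 t + 1 * powcos m k.+2 t) +
     - (k.+2%:R * k.+1%:R) * powcos m.+2 k t).
  apply: is_derive_eq => /=; rewrite /powcos /GRing.scale /= !fctE.
  set s := sin t; set c := cos t; set p := powfact _ _; set q := powfact _ _.
  set r := powfact _ _; have s2 : s ^+ 2 = 1 - c ^+ 2 := sin2cos2 t.
  rewrite !(exprS c).
  have -> : s * (p * (k.+1%:R * c ^+ k * - s) + c * c ^+ k * q) =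
      s * (c * c ^+ k) * q - s ^+ 2 * p * (k.+1%:R * c ^+ k) by ring.
  rewrite s2.
  rewrite -!(natr1 k.+1) -!(natr1 k).
  ring.
have c1 := @powcos_continuous m.+2 k.+2; have c2 := @powcos_continuous m k.+2.
have c3 := @powcos_continuous m.+2 k.
have c4 : continuous (fun t => k.+2%:R ^+ 2 * powcos m.+2 k.+2 t + 1 * powcos m k.+2 t).
  by move=> t; apply: cvgD; apply: cvgMl_tmp; [exact: c1|exact: c2].
have := int_pihalf_derive _ dF; rewrite !int_pihalf_lin // => E.
move: E; rewrite mul1r mul1r mulNr => E. apply/eqP; rewrite -subr_eq0; apply/eqP.
rewrite /wallis E; last first.
  by move=> t; apply: cvgD; apply: cvgMl_tmp; [exact: c4|exact: c3].
rewrite /F !fctE cos_pihalf !powfact0S !exprS /GRing.scale /=; ring.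
Qed.

Lemma wallis_rec0 k :
  k.+2%:R * wallis 0 k.+2 = k.+1%:R * wallis 0 k.
Proof.
pose F : R -> R := (cos ^+ k.+1 * sin).
have dF (t : R) : is_derive t (1 : R) F
    (k.+2%:R * powcos 0 k.+2 t + - (k.+1%:R) * powcos 0 k t).
  apply: is_derive_eq => /=; rewrite /powcos /GRing.scale /= !fctE.
  rewrite /powfact !expr0 invr1 !mul1r.
  have -> : sin t * (k.+1%:R * cos t ^+ k * - sin t) =
      - (sin t) ^+ 2 * (k.+1%:R * cos t ^+ k) by ring.
  rewrite sin2cos2.
  rewrite -!(natr1 k.+1) -!(natr1 k) !exprS; ring.
have c1 := @powcos_continuous 0 k.+2; have c3 := @powcos_continuous 0 k.
have := int_pihalf_derive _ dF; rewrite !int_pihalf_lin // mulNr => E.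
apply/eqP; rewrite -subr_eq0; apply/eqP.
rewrite /wallis E; last first.
  by move=> t; apply: cvgD; apply: cvgMl_tmp; [exact: c1|exact: c3].
rewrite /F !fctE cos_pihalf sin0 !exprS; ring.
Qed.

Lemma wallis_1 m : wallis m.+2 1 + wallis m 1 = powfact m.+2 (pi / 2).
Proof.
pose F : R -> R := powfact m.+2 * sin + powfact m.+1 * cos.
have dF (t : R) : is_derive t (1 : R) F (1 * powcos m.+2 1 t + 1 * powcos m 1 t).
  by apply: is_derive_eq => /=; rewrite /powcos /GRing.scale /=; ring.
have c1 := @powcos_continuous m.+2 1; have c3 := @powcos_continuous m 1.
have := int_pihalf_derive _ dF; rewrite !int_pihalf_lin // !mul1r => E.
rewrite /wallis E; last first.
  by move=> t; apply: cvgD; apply: cvgMl_tmp; [exact: c1|exact: c3].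
rewrite /F !fctE cos_pihalf sin_pihalf !powfact0S; ring.
Qed.

Lemma wallis01 : wallis 0 1 = 1.
Proof.
have dF (t : R) : is_derive t (1 : R) sin (powcos 0 1 t).
  by apply: is_derive_eq; rewrite /powcos /powfact !expr0 divr1 mul1r expr1.
rewrite /wallis (int_pihalf_derive _ dF); last exact: powcos_continuous.
by rewrite sin_pihalf sin0 subr0.
Qed.

Lemma wallis_m0 m : wallis m 0 = powfact m.+1 (pi / 2).
Proof.
have dF (t : R) : is_derive t (1 : R) (powfact m.+1) (powcos m 0 t).
  by apply: is_derive_eq; rewrite /powcos expr0 mulr1.
rewrite /wallis (int_pihalf_derive _ dF); last exact: powcos_continuous.
by rewrite powfact0S subr0.
Qed.

Lemma wallis0_gt0 n : 0 < wallis 0 n.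
Proof.
elim/ltn_ind: n => -[|[|n]] IH.
- by rewrite wallis_m0 /powfact expr1 divr1.
- by rewrite wallis01.
- rewrite -(pmulr_rgt0 _ (ltr0Sn R n.+1)) wallis_rec0 mulr_gt0 // IH //.
Qed.

(** The difference has derivative [t sin t]. *)
Lemma mul_cos_le_sin (t : R) : 0 <= t <= pi / 2 -> t * cos t <= sin t.
Proof.
move=> t01; pose F : R -> R := sin - id * cos.
have dF (x : R) : is_derive x (1 : R) F (x * sin x).
  by apply: is_derive_eq => /=; rewrite /GRing.scale /=; ring.
suff : F 0 <= F t by rewrite /F !fctE sin0 mul0r subrr subr_ge0.
case/andP: t01 => t0 t1.
apply: (@ger0_derive1_le_cc _ F 0 (pi / 2)) => //.
- move=> x; rewrite in_itv /= => /andP[x0 x1].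
  rewrite derive1E; have [_ ->] := dF x; rewrite mulr_ge0 ?(ltW x0) //.
  by apply: sin_ge0_pi; have := pi_gt0 R; rewrite (ltW x0) /=; lra.
- apply: continuous_subspaceT => x; apply: differentiable_continuous.
  by apply/derivable1_diffP; have [] := dF x.
- by rewrite in_itv /= lexx ltW.
- by rewrite in_itv /= t0.
Qed.

End Wallis.

(** * The limit of the products rho *)

Section WallisSeries.
Variable R : realType.
Local Notation Y := (@fps_var R).

(** The coefficients of the series in [y] of the integral of
[cosh (t sqrt y) cos^n t], normalised to constant term 1. *)
Definition wallis_fps n : fps R := fun N => wallis R (2 * N) n / wallis R 0 n.

Let w0_neq0 n : wallis R 0 n != 0. Proof. by rewrite gt_eqF ?wallis0_gt0. Qed.

Lemma wallis_fps_coef0 n : wallis_fps n 0 = 1.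
Proof. by rewrite /wallis_fps muln0 divff. Qed.

Let powfact_half N : powfact (2 * N) (pi / 2 : R) =
  (pi ^+ 2) ^+ N * (4^-1 ^+ N / (2 * N)`!%:R).
Proof.
rewrite /powfact mulrA; congr (_ / _); rewrite exprM -exprMn; congr (_ ^+ _).
by field.
Qed.

Lemma wallis_fps0 : wallis_fps 0 = fps_scale (pi ^+ 2) (sinhc_half R).
Proof.
apply/funext => N; rewrite /wallis_fps /fps_scale !wallis_m0 /sinhc_half.
have p0 : pi / 2 != 0 :> R by rewrite gt_eqF // divr_gt0 ?pi_gt0.
have := powfact_half N; rewrite /powfact expr1 divr1 mulrA.
have f0 k : k`!%:R != 0 :> R by rewrite pnatr_eq0 -lt0n fact_gt0.
move=> /(canRL (divfK (f0 _))) E; rewrite exprSr E factS natrM {E}.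
move: (pi / 2) p0 (pi ^+ 2 ^+ N) => p p0 q; field.
by rewrite f0 p0 -natrM nat1r pnatr_eq0.
Qed.

Lemma wallis_fps1 : (1 + Y) * wallis_fps 1 = fps_scale (pi ^+ 2) (cosh_half R).
Proof.
apply/funext => N; rewrite mulrDl mul1r fpsD fps_varM /fps_scale /cosh_half.
case: N => [|N]; first by rewrite wallis_fps_coef0 addr0 divr1 mulr1.
rewrite -powfact_half /wallis_fps wallis01 !divr1 mulnS wallis_1 //.
Qed.

Lemma wallis_fpsSS n :
  ((n.+2 ^ 2)%:R + Y) * wallis_fps n.+2 = (n.+2 ^ 2)%:R * wallis_fps n.
Proof.
apply/funext => N; rewrite mulrDl fpsD !fps_natrM fps_varM.
case: N => [|N]; first by rewrite !wallis_fps_coef0 addr0.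
rewrite mulrA -mulrDl natrX /wallis_fps mulnS wallis_rec mulrA.
apply/eqP; rewrite eqr_div ?w0_neq0 //; apply/eqP.
have -> : n.+2%:R * n.+1%:R * wallis R (2 + 2 * N) n * wallis R 0 n =
  n.+2%:R * wallis R (2 + 2 * N) n * (n.+1%:R * wallis R 0 n) by ring.
by rewrite -wallis_rec0; ring.
Qed.

Lemma wallis_fps_ge0 n N : 0 <= wallis_fps n N.
Proof.
rewrite divr_ge0 ?(ltW (wallis0_gt0 _ _)) //; apply: Rintegral_ge0 => t /=.
rewrite in_itv /= => /andP[t0 t1]; rewrite /powcos mulr_ge0 //.
  by rewrite divr_ge0 // exprn_ge0.
by rewrite exprn_ge0 // cos_ge0_pihalf // t1 andbT (le_trans _ t0) // oppr_le0 divr_ge0 ?pi_ge0.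
Qed.

(** Since [t cos t <= sin t], the factor [t^2 cos^2 t] is at most [1 - cos^2 t],
and the integrals of [cos^n t] and [cos^(n+2) t] have quotient
[(n+2) / (n+1)]. *)
Lemma wallis_fps_le N n : wallis_fps n.+2 N.+1 <= (pi / 2) ^+ (2 * N) / n.+1%:R.
Proof.
set C := (pi / 2) ^+ (2 * N).
have W0 := wallis0_gt0 R n.+2.
have : wallis R (2 * N.+1) n.+2 <= C * wallis R 0 n + (- C) * wallis R 0 n.+2.
  rewrite -int_pihalf_lin; try exact: powcos_continuous.
  apply: int_pihalf_le; first exact: powcos_continuous.
    by move=> t; apply: cvgD; apply: cvgMl_tmp; exact: powcos_continuous.
  move=> t /[dup] /mul_cos_le_sin tc /andP[t0 t1].
  have c0 : 0 <= cos t.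
    by rewrite cos_ge0_pihalf // t1 andbT (le_trans _ t0) // oppr_le0 divr_ge0 ?pi_ge0.
  rewrite /powcos {2 3}/powfact expr0 divr1 !mul1r mulNr -mulrBr.
  have -> : cos t ^+ n - cos t ^+ n.+2 = cos t ^+ n * sin t ^+ 2.
    by rewrite sin2cos2 !exprS; ring.
  have -> : powfact (2 * N.+1) t * cos t ^+ n.+2 =
      (t ^+ (2 * N) / (2 * N.+1)`!%:R) * (cos t ^+ n * (t * cos t) ^+ 2).
    by rewrite /powfact mulnS exprD !exprS; ring.
  apply: ler_pM.
  - by rewrite divr_ge0 ?exprn_ge0.
  - by rewrite mulr_ge0 ?exprn_ge0 ?mulr_ge0.
  - rewrite ler_pdivrMr ?ltr0n ?fact_gt0 //.
    apply: (@le_trans _ _ (C * 1)); last first.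
      by rewrite ler_wpM2l ?exprn_ge0 ?divr_ge0 ?pi_ge0 // ler1n fact_gt0.
    by rewrite mulr1 /C lerXn2r // nnegrE (le_trans t0).
  - rewrite ler_wpM2l ?exprn_ge0 // lerXn2r // ?nnegrE ?mulr_ge0 //.
    by rewrite (le_trans _ tc) ?mulr_ge0.
rewrite /wallis_fps ler_pdivrMr // => /le_trans; apply.
have n0 : n.+1%:R != 0 :> R by rewrite pnatr_eq0.
rewrite le_eqVlt; apply/orP; left; apply/eqP.
have -> : C * wallis R 0 n = C * (n.+1%:R^-1 * (n.+2%:R * wallis R 0 n.+2)).
  by rewrite wallis_rec0 mulKf.
rewrite -[n.+2%:R]natr1 -[n.+1%:R]natr1.
field; by rewrite natr1.
Qed.

(** Convergence of every coefficient. *)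
Definition fps_cvg (F : nat -> fps R) (f : fps R) :=
  forall N, F n N @[n --> \oo] --> f N.

Lemma fps_cvgM F G f g : fps_cvg F f -> fps_cvg G g ->
  fps_cvg (fun n => F n * G n) (f * g).
Proof.
move=> Ff Gg N; rewrite fpsM.
under eq_fun => n do rewrite fpsM.
apply: cvg_big => [|i _]; first exact: add_continuous.
by apply: cvgM; [exact: Ff|exact: Gg].
Qed.

Lemma fps_cvg_sign F (r : nat -> R) : (forall n, `|r n| = 1) ->
  fps_cvg F 1 -> fps_cvg (fun n => fps_scale (r n) (F n)) 1.
Proof.
move=> r1 F1 [|N].
  apply: (cvg_trans _ (F1 0%N)); apply: near_eq_cvg; near=> n.
  by rewrite /fps_scale mul1r.
rewrite (_ : (1 : fps R) N.+1 = 0) //; apply/norm_cvg0P.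
under eq_fun => n do rewrite normrM normrX r1 expr1n mul1r.
by apply/norm_cvg0P; exact: (F1 N.+1).
Unshelve. all: by end_near. Qed.

Lemma fps_cvg_unique F f g : fps_cvg F f -> fps_cvg F g -> f = g.
Proof.
move=> Ff Fg; apply/funext => N; exact: cvg_unique (Ff N) (Fg N).
Qed.

Lemma wallis_fps_cvg : fps_cvg wallis_fps 1.
Proof.
move=> [|N].
  rewrite (_ : (fun n => _) = cst (1 : R)); first exact: cvg_cst.
  by apply/funext => n; rewrite wallis_fps_coef0.
rewrite -(cvg_shiftn 2) (_ : (1 : fps R) N.+1 = 0) //.
apply: (@squeeze_cvgr _ _ _ _ (cst 0) (fun n => (pi / 2) ^+ (2 * N) * harmonic n)).
- near=> n; rewrite wallis_fps_ge0 /= addn2; exact: wallis_fps_le.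
- exact: cvg_cst.
- rewrite -(mulr0 ((pi / 2) ^+ (2 * N))); apply: cvgMl_tmp; exact: cvg_harmonic.
Unshelve. all: by end_near. Qed.

Definition rho_fps l : fps R := fun N => rho R N l.

Lemma fps_signM n (f : fps R) N : ((-1) ^+ n * f) N = (-1) ^+ n * f N.
Proof.
elim: n => [|n IH]; first by rewrite !mul1r.
by rewrite !exprS !mulN1r !mulNr fpsN IH.
Qed.

Lemma fps_scale_sign n : fps_scale ((-1) ^+ n) Y = (-1) ^+ n * Y.
Proof.
apply/funext => -[|[|N]]; rewrite fps_signM /fps_scale ?mulr0 // expr1.
Qed.

Lemma rho_fpsS l :
  ((l.+1 ^ 2)%:R - (-1) ^+ l * Y) * rho_fps l.+1 =
  ((l.+1 ^ 2)%:R + (-1) ^+ l * Y) * rho_fps l.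
Proof.
have l0 : l.+1%:R != 0 :> R by rewrite pnatr_eq0.
apply/funext => N; rewrite mulrBl mulrDl -!mulrA fpsD fpsN fpsD !fps_natrM.
rewrite !fps_signM !fps_varM natrX /rho_fps.
case: N => [|N]; first by rewrite mulr0 subr0 addr0.
have := rhoS R N l => /(canRL (subrK _)) ->; field.
by rewrite nat1r.
Qed.

(** The indices [n] and [n+1] cover both parities. The twists by signs are chosen
so that passing from [n] to [n+1] divides the pair by the denominator of the
factor number [n+2] of [rho]. *)
Definition wallis_pair n : fps R :=
  fps_scale ((-1) ^+ n.+1) (wallis_fps n.+1) * fps_scale ((-1) ^+ n) (wallis_fps n).

Lemma wallis_pairS n :
  ((n.+2 ^ 2)%:R + (-1) ^+ n * Y) * wallis_pair n.+1 =
  (n.+2 ^ 2)%:R * wallis_pair n.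
Proof.
have := congr1 (fps_scale ((-1) ^+ n)) (wallis_fpsSS n).
rewrite !fps_scaleM fps_scaleD !fps_scale_nat fps_scale_sign => E.
rewrite /wallis_pair [(-1) ^+ n.+2]exprS [(-1) ^+ n.+1]exprS !mulN1r opprK.
by rewrite [LHS]mulrA E; ring.
Qed.

Lemma wallis_pair_cvg : fps_cvg wallis_pair 1.
Proof.
rewrite -[1]mulr1; apply: (@fps_cvgM
  (fun n => fps_scale ((-1) ^+ n.+1) (wallis_fps n.+1))).
  apply: fps_cvg_sign => [n|N]; first by rewrite normrX normrN1 expr1n.
  by have := @wallis_fps_cvg N; rewrite -(cvg_shiftS (fun n => wallis_fps n N)).
apply: fps_cvg_sign => [n|N]; first by rewrite normrX normrN1 expr1n.
exact: wallis_fps_cvg.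
Qed.

(** The quotient of [rho] by the pair over its twist by [y |-> -y] does not
depend on [n]. *)
Lemma rho_wallis n (W := wallis_fps 0 * fps_scale (-1) ((1 + Y) * wallis_fps 1)) :
  rho_fps n.+1 * fps_scale (-1) (wallis_pair n) * W =
  wallis_pair n * fps_scale (-1) W.
Proof.
have sY : fps_scale (-1) Y = - Y by rewrite (fps_scale_sign 1) mulN1r.
have s1 (f : fps R) : fps_scale 1 f = f.
  by apply/funext => N; rewrite /fps_scale expr1n mul1r.
elim: n => [|n IH].
  rewrite /wallis_pair /W expr1 expr0 !fps_scaleM !fps_scaleK mulN1r opprK.
  rewrite !s1 mulr1 fps_scaleD sY (fps_scale_nat _ 1).
  have := rho_fpsS 0; rewrite expr0 mul1r exp1n.
  have -> : rho_fps 0 = 1 by apply/funext => N; rewrite /rho_fps rho0.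
  rewrite mulr1.
  set a := wallis_fps 0; set b := wallis_fps 1; set r := rho_fps 1.
  set a' := fps_scale _ a; set b' := fps_scale _ b => Er.
  transitivity ((1 - Y) * r * (a * a' * b * b')); first by ring.
  by rewrite Er; ring.
pose q : fps R := (n.+2 ^ 2)%:R; pose e : fps R := (-1) ^+ n * Y.
have E1 : (q + e) * wallis_pair n.+1 = q * wallis_pair n := wallis_pairS n.
have E2 : (q - e) * fps_scale (-1) (wallis_pair n.+1) =
    q * fps_scale (-1) (wallis_pair n).
  have se : fps_scale (-1) e = - e.
    by rewrite /e -{1}fps_scale_sign fps_scaleK -exprS fps_scale_sign exprS
       mulN1r mulNr.
  have := congr1 (fps_scale (-1)) E1.
  by rewrite !fps_scaleM fps_scaleD fps_scale_nat se.
have E3 : (q + e) * rho_fps n.+2 = (q - e) * rho_fps n.+1.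
  by have := rho_fpsS n.+1; rewrite exprS mulN1r mulNr opprK.
have q0 : q <> 0 by apply: (@fps_neq0 _ _ 0); rewrite /q fps_nat pnatr_eq0 expn_eq0.
have qe0 : q + e <> 0.
  apply: (@fps_neq0 _ _ 0); rewrite fpsD /q /e fps_nat fps_signM mulr0 addr0.
  by rewrite pnatr_eq0 expn_eq0.
apply: (fps_mulfI qe0); apply: (fps_mulfI q0).
set w' := fps_scale _ (wallis_pair n.+1) in E2 *.
transitivity (q * ((q + e) * rho_fps n.+2) * w' * W); first by ring.
rewrite E3; transitivity (q * rho_fps n.+1 * ((q - e) * w') * W); first by ring.
rewrite E2; set u' := fps_scale _ (wallis_pair n) in IH *.
transitivity (q * q * (rho_fps n.+1 * u' * W)); first by ring.
rewrite IH; transitivity (q * (q * wallis_pair n) * fps_scale (-1) W); first by ring.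
by rewrite -E1; ring.
Qed.

(** As the pairs tend to 1, [rho_wallis] becomes in the limit the quotient of
[sinh(ix) cosh(x)] by [sinh(x) cosh(ix)], up to a constant, where
[x = pi sqrt y / 2]: this is [tan x / tanh x]. *)
Lemma rho_limit (W := sinhc_half R * fps_scale (-1) (cosh_half R)) :
  exists2 r : fps R, fps_cvg rho_fps r &
    r * fps_scale (pi ^+ 2) W = fps_scale (pi ^+ 2) (fps_scale (-1) W).
Proof.
pose r : fps R := fun N => limn (rho R N).
have Hr : fps_cvg rho_fps r by move=> N; exact: rho_is_cvg.
exists r => //.
set V := fps_scale (pi ^+ 2) W.
have sV : fps_scale (pi ^+ 2) (fps_scale (-1) W) = fps_scale (-1) V.
  by rewrite /V !fps_scaleK mulrC.
have E n : rho_fps n.+1 * fps_scale (-1) (wallis_pair n) * V =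
    wallis_pair n * fps_scale (-1) V.
  have := rho_wallis n; rewrite wallis_fps1 wallis_fps0.
  rewrite (_ : _ * fps_scale (-1) _ = V) //.
  by rewrite /V /W [RHS]fps_scaleM !fps_scaleK mulrC [-1 * _]mulrC mulrC.
rewrite sV; apply: (@fps_cvg_unique (fun n => wallis_pair n * fps_scale (-1) V)).
  rewrite -[r]mulr1; under eq_fun => n do rewrite -E.
  apply: fps_cvgM => [|N]; last exact: cvg_cst.
  apply: fps_cvgM => [N|].
    by have := Hr N; rewrite -(cvg_shiftS (fun n => rho_fps n N)).
  apply: fps_cvg_sign => [n|]; first by rewrite normrN1.
  exact: wallis_pair_cvg.
rewrite -[X in fps_cvg _ X]mul1r; apply: fps_cvgM => [|N]; last exact: cvg_cst.
exact: wallis_pair_cvg.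
Qed.

End WallisSeries.

(** * From the Bernoulli generating function to the theorem *)

Section Bernoulli.
Variable R : realType.

(** Convergence at one point [s] bounds the coefficients by a geometric sequence,
so the series without its constant term is [O(t)] at 0. *)
Lemma pseries_eq0_coef0 (a : nat -> R) :
  (\forall t \near (0 : R)^', pseries a t @ \oo --> (0 : R)) -> a 0%N = 0.
Proof.
move=> /nbhs_ballP[e /= e0 ae].
have a_cvg (t : R) : 0 < t -> t < e -> pseries a t @ \oo --> (0 : R).
  move=> t0 te; apply: ae; last by rewrite gt_eqF.
  by rewrite /ball /= sub0r normrN gtr0_norm.
pose s := e / 2; have s0 : 0 < s by rewrite divr_gt0.
have /cvg_series_bounded[M [_ HM]] : cvgn (pseries a s).
  by apply/cvg_ex; exists 0; apply: a_cvg => //; rewrite /s; lra.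
pose K := `|M| + 1; have K0 : 0 < K by rewrite ltr_wpDl.
have aK i : `|a i| <= K / s ^+ i.
  rewrite ler_pdivlMr ?exprn_gt0 // -[s ^+ i]gtr0_norm ?exprn_gt0 // -normrM.
  apply: HM => //.
  by rewrite (le_lt_trans (ler_norm _)) // ltrDl.
have half_sum n : \sum_(i < n) (2^-1 : R) ^+ i = 2 - 2 * 2^-1 ^+ n.
  elim: n => [|n IH]; first by rewrite big_ord0 expr0; lra.
  by rewrite big_ord_recr /= IH exprS; lra.
have bound (t : R) : 0 < t -> t <= s / 2 -> `|a 0%N| <= 2 * K / s * t.
  move=> t0 ts; have c0 : 0 <= K / s * t.
    by rewrite mulr_ge0 ?divr_ge0 // ltW.
  have ts2 : t / s <= 2^-1 by rewrite ler_pdivrMr //; lra.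
  have te : t < e by move: ts; rewrite /s; lra.
  have := a_cvg t t0 te; rewrite -(cvg_shiftS (pseries a t)) => at0.
  have : (fun n => `|a 0%N - pseries a t n.+1|) @ \oo --> `|a 0%N - 0|.
    by apply: cvg_norm; apply: cvgB => //; exact: cvg_cst.
  rewrite subr0 => /cvgr_to_le; apply; near=> n.
  rewrite /pseries /series /= big_mkord big_ord_recl expr0 mulr1 opprD addrA.
  rewrite subrr sub0r normrN; apply: le_trans (ler_norm_sum _ _ _) _.
  apply: (@le_trans _ _ (\sum_(i < n) K / s * t * 2^-1 ^+ i)).
    apply: ler_sum => i _; rewrite lift0 normrM normrX (gtr0_norm t0).
    apply: (@le_trans _ _ (K / s ^+ i.+1 * t ^+ i.+1)).
      by rewrite ler_wpM2r ?aK // exprn_ge0 // ltW.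
    have -> : K / s ^+ i.+1 * t ^+ i.+1 = K / s * t * (t / s) ^+ i.
      by rewrite -mulrA [_ * t ^+ _]mulrC -expr_div_n exprS mulrA; ring.
    rewrite ler_wpM2l //; apply: lerXn2r => //; rewrite nnegrE //.
    by rewrite divr_ge0 // ltW.
  rewrite -mulr_sumr half_sum.
  have -> : 2 * K / s * t = K / s * t * 2 by ring.
  by rewrite ler_wpM2l // lerBlDr lerDl mulr_ge0 // exprn_ge0.
pose c := 2 * K / s; have c0 : 0 < c by rewrite divr_gt0 ?mulr_gt0.
apply/eqP/negPn/negP => a0; have {}a0 : 0 < `|a 0%N| by rewrite normr_gt0.
pose t := Num.min (s / 2) (`|a 0%N| / (2 * c)).
have t0 : 0 < t by rewrite lt_min divr_gt0 //= divr_gt0 // mulr_gt0.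
have := bound t t0; rewrite ge_min lexx => /(_ isT).
have : c * t <= `|a 0%N| / 2.
  have -> : `|a 0%N| / 2 = c * (`|a 0%N| / (2 * c)) by field; rewrite gt_eqF.
  by rewrite ler_wpM2l ?(ltW c0) // ge_min lexx orbT.
rewrite -/c; lra.
Unshelve. all: by end_near. Qed.

(** The identity theorem at 0, by dividing out [t] repeatedly. *)
Lemma pseries_eq0 (a : nat -> R) :
  (\forall t \near (0 : R)^', pseries a t @ \oo --> (0 : R)) ->
  forall n, a n = 0.
Proof.
move=> + n; elim: n a => [|n IH] a a0; first exact: pseries_eq0_coef0.
apply: (IH (fun i => a i.+1)); have a00 := pseries_eq0_coef0 a0.
near=> t; have t0 : t != 0 by near: t; exact: nbhs_dnbhs_neq.
have : pseries a t @ \oo --> (0 : R) by near: t; exact: a0.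
rewrite -(cvg_shiftS (pseries a t)) => at0.
have -> : pseries (fun i => a i.+1) t = (fun n => t^-1 * pseries a t n.+1).
  apply/funext => k; rewrite /pseries /series /= !big_mkord big_ord_recl a00.
  rewrite mul0r add0r mulr_sumr; apply: eq_bigr => i _.
  by rewrite lift0 exprS mulrCA mulKf.
by rewrite -(mulr0 t^-1); apply: cvgMl_tmp.
Unshelve. all: by end_near. Qed.

(** The formal inverse [b] of [(e^t - 1) / t] has bounded coefficients, so its
series converges near 0, to the same function as the series of the hypothesis;
the identity theorem then gives equality of the coefficients. *)
Lemma bernoulli_fps (B : nat -> R) : is_bernoulli B ->
  ((fun n => B n / n`!%:R) : fps R) * expm1_coeff R = 1.
Proof.
move=> hB; have [b hb] := expm1_coeff_inverse R.
suff -> : (fun n => B n / n`!%:R) = b by apply/funext => n; exact: hb.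
apply/funext => n; apply/eqP; rewrite -subr_eq0; apply/eqP; move: n.
apply: pseries_eq0; near=> t.
have t0 : t != 0 by near: t; exact: nbhs_dnbhs_neq.
have t8 : `|t| < 8^-1 by near: t; apply: dnbhs0_lt; rewrite invr_gt0.
have Bt : pseries (fun n => B n / n`!%:R) t @ \oo --> t / (expR t - 1).
  by near: t; exact: hB.
pose c := expm1_coeff R; pose e := (expR t - 1) / t.
have e0 : e != 0.
  by rewrite mulf_neq0 ?invr_eq0 // subr_eq0 -expR0 (inj_eq (@expR_inj R)).
have c_cvg : (fun n => \sum_(i < n) c i * t ^+ i) @ \oo --> e.
  have -> : (fun n => \sum_(i < n) c i * t ^+ i) =
            (fun n => (series (exp_coeff t) n.+1 - 1) / t).
    apply/funext => n; rewrite /series /= big_mkord big_ord_recl /exp_coeff /=.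
    rewrite expr0 divr1 addrC addrA addNr add0r mulr_suml; apply: eq_bigr => i _.
    rewrite /c /expm1_coeff /bump /= add1n exprS; field.
    by rewrite t0 pnatr_eq0 -lt0n fact_gt0.
  apply: cvgMr_tmp; apply: cvgB; last exact: cvg_cst.
  by have := @is_cvg_series_exp_coeff _ t; rewrite -(cvg_shiftS (series _)).
have bc_cvg : (fun n => (\sum_(i < n) b i * t ^+ i) *
    (\sum_(i < n) c i * t ^+ i)) @ \oo --> (1 : R).
  apply/subr_cvg0/norm_cvg0P => /=.
  apply: (@squeeze_cvgr _ _ _ _ (cst 0) (geometric (2 : R) 2^-1)).
  - near=> n; rewrite normr_ge0 /=; apply: expm1_inverse_prod => //.
    by near: n; exists 1%N.
  - exact: cvg_cst.
  - by apply: cvg_geometric; rewrite ger0_norm ?invr_ge0 // invf_lt1 // ltr1n.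
have bt : pseries b t @ \oo --> t / (expR t - 1).
  rewrite -[t / _]mul1r -(invf_div (expR t - 1)).
  apply: (cvg_trans _ (cvgM bc_cvg (cvgV e0 c_cvg))); apply: near_eq_cvg.
  have c_neq0 := cvgr_neq0 _ c_cvg e0.
  near=> n; rewrite /pseries /series /= big_mkord mulfK //; near: n; exact: c_neq0.
have -> : pseries (fun n => B n / n`!%:R - b n) t =
    (fun n => pseries (fun n => B n / n`!%:R) t n - pseries b t n).
  apply/funext => n; rewrite /pseries /series /= -sumrB.
  by apply: eq_bigr => i _; rewrite mulrBl.
by rewrite -(subrr (t / (expR t - 1))); apply: cvgB.
Unshelve. all: by end_near. Qed.

(** With [W] as in [rho_limit], both the limit of [rho] and the Bernoulli
convolution, after the substitution of [pi^2 y] for [y], solve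
[X * W(y) = W(-y)]. *)
Lemma zeta_star_index (B : nat -> R) N : is_bernoulli B ->
  zeta_star R (star_index N) =
  (4 * pi ^+ (2 * N) * \sum_(k < N.+1)
     (-1) ^+ k * (4 ^+ k.+1 - 1) * (B (2 * k + 2)%N / (2 * k + 2)`!%:R) *
     (B (2 * (N - k))%N / (2 * (N - k))`!%:R))%:E.
Proof.
move=> hB; have [] := bernoulli_coth_tanh (bernoulli_fps hB).
set D := fps_even _; set T : fps R := fun n => _ => DE TE.
pose W := sinhc_half R * fps_scale (-1) (cosh_half R).
have [r r_cvg] := rho_limit R; rewrite -/W => rE.
pose A := 4%:R * fps_scale (-1) T * D.
have AW : A * W = fps_scale (-1) W.
  rewrite /W fps_scaleM fps_scaleK.
  have -> : fps_scale (-1 * -1) (cosh_half R) = cosh_half R.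
    by apply/funext => n; rewrite /fps_scale mulrNN mulr1 expr1n mul1r.
  transitivity (fps_scale (-1) (4%:R * T * cosh_half R) * (D * sinhc_half R)).
    by rewrite !fps_scaleM fps_scale_nat /A; ring.
  by rewrite TE DE.
have W0 : fps_scale (pi ^+ 2) W <> 0.
  apply: (@fps_neq0 _ _ 0); rewrite /fps_scale mul1r /W fpsM big_ord1.
  by rewrite /fps_scale /sinhc_half /cosh_half !expr0 !mul1r muln0 invr1 mulr1 oner_eq0.
have {}rE : r = fps_scale (pi ^+ 2) A.
  apply: (fps_mulfI W0); rewrite mulrC rE -AW fps_scaleM mulrC //.
rewrite (@zeta_star_cvg _ _ (r N)).
  congr (_%:E); rewrite rE /fps_scale /A -mulrA fps_natrM fpsM exprM mulrCA mulrA.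
  congr (_ * _); apply: eq_bigr => k _; rewrite /fps_scale /T /D /fps_even.
  by rewrite !mulrA.
rewrite (_ : (fun n => _) = kernel_mean (rho R N)).
  by apply: kernel_mean_cvg; exact: r_cvg.
by apply/funext => n; rewrite star_sum_index.
Qed.

End Bernoulli.

Theorem theorem1p1 (R : realType) (B : nat -> R) (hB : is_bernoulli B)
    (d : nat) :
  zeta_star R (repeat_index d [:: 3; 1]%N) =
    (4 * pi ^+ (4 * d) *
      \sum_(0 <= k < (2 * d).+1)
        (-1) ^+ k * (4 ^+ k.+1 - 1) *
        (B (2 * k + 2)%N / ((2 * k + 2)`!)%:R) *
        (B (4 * d - 2 * k)%N / ((4 * d - 2 * k)`!)%:R))%:E
  /\
  zeta_star R (repeat_index d [:: 3; 1]%N ++ [:: 2]%N) =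
    (4 * pi ^+ (4 * d + 2) *
      \sum_(0 <= k < (2 * d + 1).+1)
        (-1) ^+ k * (4 ^+ k.+1 - 1) *
        (B (2 * k + 2)%N / ((2 * k + 2)`!)%:R) *
        (B (4 * d + 2 - 2 * k)%N / ((4 * d + 2 - 2 * k)`!)%:R))%:E.
Proof.
split.
  rewrite -star_index_even (zeta_star_index _ hB) big_mkord.
  rewrite (_ : 4 * d = 2 * (2 * d))%N; last by lia.
  by congr (_ * _)%:E; apply: eq_bigr => k _; rewrite mulnBr.
rewrite -star_index_odd (zeta_star_index _ hB) addn1 big_mkord.
rewrite (_ : 4 * d + 2 = 2 * (2 * d).+1)%N; last by lia.
by congr (_ * _)%:E; apply: eq_bigr => k _; rewrite mulnBr.
Qed.
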